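(* Let $A\in\mathcal{R}(\mathbb{T},\mathbb{H}^{n\times n})$ and $f:\mathbb{T}\to\mathbb{H}^n$. Suppose that $M(t)$ is a fundamental solution matrix of $\phi^\Delta(t)=A(t)\phi(t)$ and that $\phi_0^{NH}(t)$ is a solution of $\phi^\Delta(t)=A(t)\phi(t)+f(t)$. Then any solution $\phi^{NH}(t)$ of $\phi^\Delta(t)=A(t)\phi(t)+f(t)$ can be expressed as $$\phi^{NH}(t)=M(t)q+\phi_0^{NH}(t),\qquad t\in\mathbb{T},$$ where $q=(q_1,\dots,q_n)^\top\in\mathbb{H}^n$ is a constant quaternion vector.
   Context: A time scale $\mathbb{T}$ is a nonempty closed subset of $\mathbb{R}$. For $t\in\mathbb{T}$: $\sigma(t)=\inf\{s\in\mathbb{T}:s>t\}$, $\rho(t)=\sup\{s\in\mathbb{T}:s<t\}$ (with $\inf\emptyset=\sup\mathbb{T}$, $\sup\emptyset=\inf\mathbb{T}$), $\mu(t)=\sigma(t)-t$. The point $t$ is right-dense if $\sigma(t)=t$ and left-dense if $\rho(t)=t$. $\mathbb{T}^\kappa=\mathbb{T}\setminus(\rho(\sup\mathbb{T}),\sup\mathbb{T}]$ if $\sup\mathbb{T}<\infty$, and $\mathbb{T}^\kappa=\mathbb{T}$ otherwise. $\mathbb{H}$ is the skew field of quaternions. A function $g:\mathbb{T}\to\mathbb{H}$ has delta derivative $g^\Delta(t)$ at $t\in\mathbb{T}^\kappa$ if for every $\varepsilon>0$ there is $\delta>0$ with $|g(\sigma(t))-g(s)-g^\Delta(t)(\sigma(t)-s)|\le\varepsilon|\sigma(t)-s|$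 for all $s\in(t-\delta,t+\delta)\cap\mathbb{T}$. $g$ is rd-continuous if each of its four real components is continuous at right-dense points and has finite left-sided limits at left-dense points. For vector- and matrix-valued functions these notions are entrywise. $\mathcal{R}(\mathbb{T},\mathbb{H}^{n\times n})$ is the set of rd-continuous $A:\mathbb{T}\to\mathbb{H}^{n\times n}$ that are regressive, i.e. $I_n+\mu(t)A(t)$ is invertible for all $t\in\mathbb{T}^\kappa$. A solution of a dynamic equation is a delta differentiable function $\mathbb{T}\to\mathbb{H}^n$ satisfying it at every $t\in\mathbb{T}^\kappa$. Functions $x_1,\dots,x_n:\mathbb{T}\to\mathbb{H}^n$ are right linearly independent on $\mathbb{T}$ if $x_1(t)\alpha_1+\dots+x_n(t)\alpha_n=0$ for all $t\in\mathbb{T}$, with $\alpha_i\in\mathbb{H}$, implies all $\alpha_i=0$. A fundamental solution matrix of $\phi^\Delta=A\phi$ is an $n\times n$ matrix function whose columns are $n$ right linearly independent solutions. *)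

(* Defs.v *)
From HB Require Import structures.
From mathcomp Require Import all_boot all_order all_algebra ring lra.
From mathcomp Require Import all_classical all_reals all_analysis.

Set Implicit Arguments.
Unset Strict Implicit.
Unset Printing Implicit Defensive.

Import Order.TTheory GRing.Theory Num.Theory.
Import numFieldNormedType.Exports.

Local Open Scope classical_set_scope.
Local Open Scope ring_scope.

(* [Quat a b c d] is a + b i + c j + d k. *)
Record quat (R : realType) := Quat { q_1 : R; q_i : R; q_j : R; q_k : R }.

Section QuatRing.
Variable R : realType.
Notation H := (quat R).
Implicit Types x y z : H.

Definition quat_tuple x := (q_1 x, q_i x, q_j x, q_k x).
Definition tuple_quat (u : R * R * R * R) : H :=
  Quat u.1.1.1 u.1.1.2 u.1.2 u.2.

Lemma quat_tupleK : cancel quat_tuple tuple_quat.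
Proof. by case. Qed.

HB.instance Definition _ := Choice.copy H (can_type quat_tupleK).

Definition addq x y :=
  Quat (q_1 x + q_1 y) (q_i x + q_i y) (q_j x + q_j y) (q_k x + q_k y).

Definition oppq x := Quat (- q_1 x) (- q_i x) (- q_j x) (- q_k x).

(* i^2 = j^2 = k^2 = ijk = -1 *)
Definition mulq x y :=
  Quat (q_1 x * q_1 y - q_i x * q_i y - q_j x * q_j y - q_k x * q_k y)
       (q_1 x * q_i y + q_i x * q_1 y + q_j x * q_k y - q_k x * q_j y)
       (q_1 x * q_j y - q_i x * q_k y + q_j x * q_1 y + q_k x * q_i y)
       (q_1 x * q_k y + q_i x * q_j y - q_j x * q_i y + q_k x * q_1 y).

Definition qreal (a : R) : H := Quat a 0 0 0.

Let quatP x y : q_1 x = q_1 y -> q_i x = q_i y -> q_j x = q_j y ->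
  q_k x = q_k y -> x = y.
Proof. by case: x => ? ? ? ?; case: y => ? ? ? ? /= -> -> -> ->. Qed.

Fact addqA : associative addq.
Proof. by move=> x y z; apply: quatP => /=; ring. Qed.
Fact addqC : commutative addq.
Proof. by move=> x y; apply: quatP => /=; ring. Qed.
Fact add0q : left_id (qreal 0) addq.
Proof. by move=> x; apply: quatP => /=; ring. Qed.
Fact addNq : left_inverse (qreal 0) oppq addq.
Proof. by move=> x; apply: quatP => /=; ring. Qed.

HB.instance Definition _ := GRing.isZmodule.Build H addqA addqC add0q addNq.

Fact mulqA : associative mulq.
Proof. by move=> x y z; apply: quatP => /=; ring. Qed.
Fact mul1q : left_id (qreal 1) mulq.
Proof. by move=> x; apply: quatP => /=; ring. Qed.
Fact mulq1 : right_id (qreal 1) mulq.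
Proof. by move=> x; apply: quatP => /=; ring. Qed.
Fact mulqDl : left_distributive mulq addq.
Proof. by move=> x y z; apply: quatP => /=; ring. Qed.
Fact mulqDr : right_distributive mulq addq.
Proof. by move=> x y z; apply: quatP => /=; ring. Qed.
Fact oneq_neq0 : qreal 1 != qreal 0.
Proof. by apply/eqP => -[] /eqP; rewrite oner_eq0. Qed.

HB.instance Definition _ :=
  GRing.Zmodule_isNzRing.Build H mulqA mul1q mulq1 mulqDl mulqDr oneq_neq0.

Definition qnorm2 x := q_1 x ^+ 2 + q_i x ^+ 2 + q_j x ^+ 2 + q_k x ^+ 2.

Definition qnorm x : R := Num.sqrt (qnorm2 x).

Definition invq x :=
  Quat (q_1 x / qnorm2 x) (- q_i x / qnorm2 x)
       (- q_j x / qnorm2 x) (- q_k x / qnorm2 x).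

Fact qnorm2_eq0 x : (qnorm2 x == 0) = (x == 0).
Proof.
apply/eqP/eqP => [|->]; last by rewrite /qnorm2 /=; ring.
move=> /eqP; rewrite /qnorm2 !paddr_eq0 ?addr_ge0 ?sqr_ge0 // !sqrf_eq0.
by move=> /andP[/andP[/andP[/eqP ? /eqP ?] /eqP ?] /eqP ?]; apply: quatP.
Qed.

Fact mulVq : {in [pred x | x != 0], left_inverse 1 invq *%R}.
Proof.
move=> x; rewrite inE -qnorm2_eq0 => x0.
by apply: quatP => /=; move: x0; rewrite /qnorm2 => x0; field.
Qed.

Fact mulqV : {in [pred x | x != 0], right_inverse 1 invq *%R}.
Proof.
move=> x; rewrite inE -qnorm2_eq0 => x0.
by apply: quatP => /=; move: x0; rewrite /qnorm2 => x0; field.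
Qed.

Fact unitqP x y : y * x = 1 /\ x * y = 1 -> x != 0.
Proof.
by case=> + _; apply: contra_eq_neq => ->; rewrite mulr0 eq_sym oner_eq0.
Qed.

Fact invq_out : {in [predC [pred x | x != 0]], invq =1 id}.
Proof.
move=> x; rewrite !inE negbK => /eqP ->.
by apply: quatP => /=; rewrite ?oppr0 mul0r.
Qed.

HB.instance Definition _ :=
  GRing.NzRing_hasMulInverse.Build H mulVq mulqV unitqP invq_out.

End QuatRing.

(* [unitmx] is only available over commutative rings. *)
Definition invertible_mx (S : nzRingType) n (B : 'M[S]_n) :=
  exists C : 'M[S]_n, B *m C = 1%:M /\ C *m B = 1%:M.

(* Functions on a time scale [T : set R] are represented by total functions
   on [R]; every notion below only looks at their values on [T]. *)
Section TimeScale.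
Variables (R : realType) (T : set R).
Notation H := (quat R).

Definition time_scale := closed T /\ T !=set0.

Definition sigma (t : R) : R :=
  let S := [set s | T s /\ t < s] in
  if `[< S !=set0 >] then inf S else sup T.

Definition rho (t : R) : R :=
  let S := [set s | T s /\ s < t] in
  if `[< S !=set0 >] then sup S else inf T.

Definition mu (t : R) : R := sigma t - t.

Definition right_dense (t : R) := sigma t = t.

Definition left_dense (t : R) := rho t = t.

Definition Tkappa : set R :=
  [set t | T t /\ (has_ubound T -> ~ (rho (sup T) < t <= sup T))].

Definition is_delta_derive (g : R -> H) (t : R) (d : H) :=
  forall e : R, 0 < e -> exists2 delta : R, 0 < delta &
    forall s : R, T s -> t - delta < s < t + delta ->
      qnorm (g (sigma t) - g s - d * qreal (sigma t - s))
        <= e * `|sigma t - s|.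

Definition rd_continuous_real (g : R -> R) :=
  forall t, T t ->
    (right_dense t -> g s @[s --> within T (nbhs t)] --> g t) /\
    (left_dense t -> exists l : R, g s @[s --> within T t^'-] --> l).

Definition rd_continuous (g : R -> H) :=
  [/\ rd_continuous_real (fun t => q_1 (g t)),
      rd_continuous_real (fun t => q_i (g t)),
      rd_continuous_real (fun t => q_j (g t)) &
      rd_continuous_real (fun t => q_k (g t))].

Definition is_delta_derive_mx m n (g : R -> 'M[H]_(m, n)) (t : R)
    (d : 'M[H]_(m, n)) :=
  forall i j, is_delta_derive (fun s => g s i j) t (d i j).

Definition rd_continuous_mx m n (g : R -> 'M[H]_(m, n)) :=
  forall i j, rd_continuous (fun t => g t i j).

Definition regressive n (A : R -> 'M[H]_n) :=
  forall t, Tkappa t -> invertible_mx (1%:M + qreal (mu t) *: A t).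

Definition rd_regressive n (A : R -> 'M[H]_n) :=
  rd_continuous_mx A /\ regressive A.

(* [x] is a solution of x^Delta(t) = F(t, x(t)) *)
Definition is_solution n (F : R -> 'cV[H]_n -> 'cV[H]_n) (x : R -> 'cV[H]_n) :=
  forall t, Tkappa t -> is_delta_derive_mx x t (F t (x t)).

Definition right_lin_indep m n (x : 'I_m -> R -> 'cV[H]_n) :=
  forall a : 'I_m -> H,
    (forall t, T t -> \sum_j map_mx (fun z => z * a j) (x j t) = 0) ->
    forall j, a j = 0.

Definition fundamental_matrix n (A : R -> 'M[H]_n) (M : R -> 'M[H]_n) :=
  (forall j, is_solution (fun t v => A t *m v) (fun t => col j (M t))) /\
  right_lin_indep (fun j t => col j (M t)).

End TimeScale.

(* Main.v *)
Require Import Defs.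
From HB Require Import structures.
From mathcomp Require Import all_boot all_order all_algebra ring lra.
From mathcomp Require Import all_classical all_reals all_analysis.

(* A solution of the homogeneous equation that vanishes at one point of [T]
   vanishes on [T].  This propagates by induction along the closed set [T], in
   both directions: across a gap by the jump formula
   [x (sigma t) = (1 + mu t A t) x t], inverted thanks to regressivity when
   going left; and near a dense point because [A] is bounded there, so that on
   a short interval the mean value inequality halves every bound on [x].
   Hence [M t0] is injective on [H^n] for any [t0] in [T], thus surjective, and
   [q] is found by solving [M t0 q = phi t0 - phi0 t0]. *)

Set Implicit Arguments.
Unset Strict Implicit.

Import Order.TTheory GRing.Theory Num.Theory.

Local Open Scope ring_scope.

(** * Induction along a closed subset of the real line *)

Section ClosedSetInduction.
Import numFieldNormedType.Exports.
Local Open Scope classical_set_scope.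
Variable R : realType.
Implicit Types (T S : set R) (P : R -> Prop).

Lemma closed_sup_mem T S :
  closed T -> S `<=` T -> S !=set0 -> has_ubound S -> T (sup S).
Proof.
move=> cT ST S0 Sb; rewrite (iffLR (closure_id T) cT).
exact: closure_subset ST _ (closure_sup S0 Sb).
Qed.

Lemma closed_inf_mem T S :
  closed T -> S `<=` T -> S !=set0 -> has_lbound S -> T (inf S).
Proof.
move=> cT ST S0 Sb; rewrite (iffLR (closure_id T) cT); apply: (closure_subset ST).
move=> B /nbhs_ballP[e /= e0 eB].
have [u Su ue] := inf_adherent e0 (conj S0 Sb).
exists u; split=> //; apply: eB; rewrite /ball /=.
by rewrite ler0_norm ?subr_le0 ?ge_inf//; lra.
Qed.

(** Let [c] be the infimum of the counterexamples, a point of [T] by closedness. [P] holds on [T]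
    between [a] and [c], hence at [c], through the jump or the limit rule. Then [right] excludes
    counterexamples just after [c], against the choice of [c]. *)
Lemma closed_set_ind_right T P a : closed T -> T a -> P a ->
  (forall t u, T t -> T u -> a <= t -> t < u ->
     (forall s, T s -> ~ (t < s < u)) -> P t -> P u) ->
  (forall t, T t -> a <= t -> P t -> \forall s \near t, T s -> t < s -> P s) ->
  (forall t, T t -> a < t ->
     (forall e, 0 < e -> exists2 s, T s & t - e < s < t) ->
     (forall s, T s -> a <= s -> s < t -> P s) -> P t) ->
  forall t, T t -> a <= t -> P t.
Proof.
move=> cT Ta Pa jump right limit b Tb ab; apply: contrapT => nPb.
pose U := [set t | [/\ T t, a <= t & ~ P t]].
have U0 : U !=set0 by exists b.
have Ub : has_lbound U by exists a => t [].
have Tc : T (inf U) by apply: closed_inf_mem => // t [].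
set c := inf U in Tc.
have ac : a <= c by apply: lb_le_inf => // t [].
have Pl s : T s -> a <= s -> s < c -> P s.
  move=> Ts as_ sc; apply: contrapT => nPs.
  by have := ge_inf Ub (And3 Ts as_ nPs); rewrite leNgt sc.
have Pc : P c.
  have [<-//|ltac] : a = c \/ a < c by case: ltgtP ac; [right|  |left].
  have [lim|] := pselect (forall e, 0 < e -> exists2 s, T s & c - e < s < c).
    exact: limit.
  move=> /existsNP[e /not_implyP[e0 nlim]].
  (* As [c] is not a limit from the left, [sup V] is the last point of [T] before [c], and the two
     bound a gap. *)
  pose V := [set s | T s /\ s < c].
  have Va : V a by [].
  have Vb : has_ubound V by exists c => s [_ /ltW].
  have Tp : T (sup V) by apply: closed_sup_mem => //; [move=> s [] | exists a].
  have pc : sup V <= c - e.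
    apply: ge_sup; first by exists a.
    move=> s [Ts sc]; rewrite leNgt; apply/negP => se.
    by apply: nlim; exists s => //; rewrite se.
  apply: (jump (sup V)) => //; first exact: ub_le_sup.
  - by lra.
  - move=> s Ts /andP[ps sc].
    by have := ub_le_sup Vb (conj Ts sc); rewrite leNgt ps.
  - by apply: Pl => //; [exact: ub_le_sup | lra].
have /nbhs_ballP[e /= e0 Pr] := right _ Tc ac Pc.
have [u [Tu au nPu] uc] := inf_adherent e0 (conj U0 Ub).
have cu : c <= u by apply: ge_inf.
have ltcu : c < u by rewrite lt_neqAle cu andbT; apply: contra_notN nPu => /eqP <-.
by apply: nPu; apply: Pr => //; rewrite /ball /= ltr0_norm ?subr_lt0//; lra.
Qed.

(** The reflection [t |-> - t] turns this into the rightward induction on the mirrored set. *)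
Lemma closed_set_ind_left T P b : closed T -> T b -> P b ->
  (forall t u, T t -> T u -> u <= b -> t < u ->
     (forall s, T s -> ~ (t < s < u)) -> P u -> P t) ->
  (forall t, T t -> t <= b -> P t -> \forall s \near t, T s -> s < t -> P s) ->
  (forall t, T t -> t < b ->
     (forall e, 0 < e -> exists2 s, T s & t < s < t + e) ->
     (forall s, T s -> s <= b -> t < s -> P s) -> P t) ->
  forall t, T t -> t <= b -> P t.
Proof.
move=> cT Tb Pb jump left limit t Tt tb.
rewrite -(opprK t).
apply: (@closed_set_ind_right [set s | T (- s)] (fun s => P (- s)) (- b)).
- by apply: closed_comp cT => x _; exact: oppr_continuous.
- by rewrite /= opprK.
- by rewrite opprK.
- move=> s u /= Ts Tu bs su nb; apply: jump => //; rewrite ?ltrN2 1?lerNl //.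
  move=> v Tv /andP[uv vs]; apply: (nb (- v)); rewrite ?opprK //.
  by rewrite ltrNr vs ltrNl uv.
- move=> s /= Ts bs /(left _ Ts) => /(_ _)/nbhs_ballP[|e /= e0 H].
    by rewrite lerNl.
  apply/nbhs_ballP; exists e => //= u su Tu ltsu; apply: H => //.
    by move: su; rewrite /ball /= distrC opprK [- s + u]addrC.
  by rewrite ltrN2.
- move=> s /= Ts bs lim H; apply: limit => //; first by rewrite ltrNl.
    move=> e /lim[u /= Tu /andP[eu us]]; exists (- u) => //.
    by apply/andP; split; lra.
  move=> u Tu ub su; rewrite -(opprK u); apply: H; [by rewrite /= opprK | lra | lra].
- by rewrite /= opprK.
- by rewrite lerN2.
Qed.

End ClosedSetInduction.

(** * The l1 norm on quaternions *)

Section QuaternionNorm.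
Variable R : realType.
Notation H := (quat R).
Implicit Types (x y z : H) (r : R).

(* Used instead of the equivalent [qnorm] because its triangle inequality and
   submultiplicativity need no square roots. *)
Definition qnorm1 x := `|q_1 x| + `|q_i x| + `|q_j x| + `|q_k x|.

Lemma qnorm1_ge0 x : 0 <= qnorm1 x.
Proof. by rewrite /qnorm1 !addr_ge0. Qed.

Lemma qnorm10 : qnorm1 0 = 0.
Proof. by rewrite /qnorm1 /= normr0 !addr0. Qed.

Lemma qnorm1_eq0 x : qnorm1 x = 0 -> x = 0.
Proof.
rewrite /qnorm1 => /eqP; rewrite !paddr_eq0 ?addr_ge0// !normr_eq0.
by case: x => a b c d /= /andP[/andP[/andP[/eqP-> /eqP->] /eqP->] /eqP->].
Qed.

Lemma qnorm1N x : qnorm1 (- x) = qnorm1 x.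
Proof. by rewrite /qnorm1 /= !normrN. Qed.

Lemma ler_qnorm1D x y : qnorm1 (x + y) <= qnorm1 x + qnorm1 y.
Proof.
rewrite /qnorm1 /=.
have := (ler_normD (q_1 x) (q_1 y), ler_normD (q_i x) (q_i y),
         ler_normD (q_j x) (q_j y), ler_normD (q_k x) (q_k y)).
by move=> [[[]]]; lra.
Qed.

(** These are the four sign patterns of the components in [mulq], in order. *)
Lemma ler_norm_addB4 (a b c d e f g h : R) :
  [/\ `|a * b - c * d - e * f - g * h| <=
        `|a| * `|b| + `|c| * `|d| + `|e| * `|f| + `|g| * `|h|,
      `|a * b + c * d + e * f - g * h| <=
        `|a| * `|b| + `|c| * `|d| + `|e| * `|f| + `|g| * `|h|,
      `|a * b - c * d + e * f + g * h| <=
        `|a| * `|b| + `|c| * `|d| + `|e| * `|f| + `|g| * `|h| &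
      `|a * b + c * d - e * f + g * h| <=
        `|a| * `|b| + `|c| * `|d| + `|e| * `|f| + `|g| * `|h|].
Proof.
have H (x y z w : R) : `|x + y + z + w| <= `|x| + `|y| + `|z| + `|w|.
  apply: le_trans (ler_normD _ _) _; rewrite lerD2r.
  by apply: le_trans (ler_normD _ _) _; rewrite lerD2r ler_normD.
by split; apply: le_trans (H _ _ _ _) _; rewrite ?normrN !normrM.
Qed.

Lemma ler_qnorm1M x y : qnorm1 (x * y) <= qnorm1 x * qnorm1 y.
Proof.
rewrite /qnorm1 /=.
case: x y => a b c d [a' b' c' d'] /=.
have [h1 _ _ _] := ler_norm_addB4 a a' b b' c c' d d'.
have [_ h2 _ _] := ler_norm_addB4 a b' b a' c d' d c'.
have [_ _ h3 _] := ler_norm_addB4 a c' b d' c a' d b'.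
have [_ _ _ h4] := ler_norm_addB4 a d' b c' c b' d a'.
apply: le_trans (lerD (lerD (lerD h1 h2) h3) h4) _.
(* Both sides expand to the same sixteen products of absolute values. *)
by rewrite le_eqVlt; apply/orP; left; apply/eqP; ring.
Qed.

Lemma qnorm1_real r : qnorm1 (qreal r) = `|r|.
Proof. by rewrite /qnorm1 /= normr0 !addr0. Qed.

Lemma qreal_comm r x : qreal r * x = x * qreal r.
Proof. by case: x => a b c d; congr Quat => /=; ring. Qed.

Lemma qrealB r s : qreal (r - s) = qreal r - qreal s.
Proof. by congr Quat => /=; ring. Qed.

Lemma qnorm1_le_qnorm x : qnorm1 x <= 4 * qnorm x.
Proof.
have H (a b : R) : 0 <= b -> `|a| <= Num.sqrt (a ^+ 2 + b).
  by move=> b0; rewrite -sqrtr_sqr ler_wsqrtr // lerDl.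
have h1 : `|q_1 x| <= qnorm x.
  by rewrite /qnorm /qnorm2 -!addrA H // !addr_ge0 ?sqr_ge0.
have h2 : `|q_i x| <= qnorm x.
  rewrite /qnorm /qnorm2 -!addrA addrCA H // !addr_ge0 ?sqr_ge0 //.
have h3 : `|q_j x| <= qnorm x.
  rewrite /qnorm /qnorm2 addrAC (addrC _ (q_j x ^+ 2)) H // !addr_ge0 ?sqr_ge0 //.
have h4 : `|q_k x| <= qnorm x.
  rewrite /qnorm /qnorm2 (addrC _ (q_k x ^+ 2)) H // !addr_ge0 ?sqr_ge0 //.
by rewrite /qnorm1; lra.
Qed.

End QuaternionNorm.

(** * The entrywise l1 norm on quaternion matrices *)

Section MatrixNorm.
Variable R : realType.
Notation H := (quat R).

Definition mxnorm1 m n (B : 'M[H]_(m, n)) : R := \sum_i \sum_j qnorm1 (B i j).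

Lemma mxnorm1_ge0 m n (B : 'M[H]_(m, n)) : 0 <= mxnorm1 B.
Proof. by apply: sumr_ge0 => i _; apply: sumr_ge0 => j _; exact: qnorm1_ge0. Qed.

Lemma mxnorm10 m n : mxnorm1 (0 : 'M[H]_(m, n)) = 0.
Proof. by rewrite /mxnorm1 big1 // => i _; rewrite big1 // => j _;
  rewrite mxE qnorm10. Qed.

Lemma mxnorm1_le0 m n (B : 'M[H]_(m, n)) : mxnorm1 B <= 0 -> B = 0.
Proof.
move=> B0; have : mxnorm1 B == 0 by rewrite eq_le B0 mxnorm1_ge0.
rewrite psumr_eq0 => [/allP Bi|i _]; last first.
  by apply: sumr_ge0 => j _; exact: qnorm1_ge0.
apply/matrixP => i j; rewrite mxE; apply: qnorm1_eq0; apply/eqP.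
have := Bi i (mem_index_enum i).
rewrite psumr_eq0 => [/allP Bij|k _]; last exact: qnorm1_ge0.
exact: Bij j (mem_index_enum j).
Qed.

Lemma mxnorm1N m n (B : 'M[H]_(m, n)) : mxnorm1 (- B) = mxnorm1 B.
Proof. by apply: eq_bigr => i _; apply: eq_bigr => j _; rewrite mxE qnorm1N. Qed.

Lemma ler_mxnorm1D m n (B C : 'M[H]_(m, n)) :
  mxnorm1 (B + C) <= mxnorm1 B + mxnorm1 C.
Proof.
rewrite /mxnorm1 -big_split; apply: ler_sum => i _ /=.
by rewrite -big_split; apply: ler_sum => j _ /=; rewrite mxE ler_qnorm1D.
Qed.

Lemma ler_mxnorm1B m n (B C : 'M[H]_(m, n)) :
  mxnorm1 (B - C) <= mxnorm1 B + mxnorm1 C.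
Proof. by rewrite -(mxnorm1N C) ler_mxnorm1D. Qed.

Lemma ler_qnorm1_sum (I : finType) (F : I -> H) :
  qnorm1 (\sum_i F i) <= \sum_i qnorm1 (F i).
Proof.
elim/big_ind2: _ => [|x a y b xa yb|//]; first by rewrite qnorm10.
by apply: le_trans (ler_qnorm1D _ _) _; exact: lerD.
Qed.

Lemma ler_mxnorm1M m n p (B : 'M[H]_(m, n)) (C : 'M[H]_(n, p)) :
  mxnorm1 (B *m C) <= mxnorm1 B * mxnorm1 C.
Proof.
rewrite /mxnorm1 mulr_suml; apply: ler_sum => i _.
apply: (@le_trans _ _ (\sum_j \sum_k qnorm1 (B i k) * qnorm1 (C k j))).
  apply: ler_sum => j _; rewrite mxE; apply: le_trans (ler_qnorm1_sum _) _.
  by apply: ler_sum => k _; exact: ler_qnorm1M.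
rewrite exchange_big mulr_suml; apply: ler_sum => k _ /=.
(* Row [k] of [C] contributes one of the nonnegative summands of [mxnorm1 C]. *)
rewrite -mulr_sumr ler_wpM2l ?qnorm1_ge0 // [leRHS](bigD1 k) //= lerDl.
by apply: sumr_ge0 => l _; apply: sumr_ge0 => j _; exact: qnorm1_ge0.
Qed.

Lemma ler_mxnorm1Z m n r (B : 'M[H]_(m, n)) :
  mxnorm1 (qreal r *: B) <= `|r| * mxnorm1 B.
Proof.
rewrite /mxnorm1 mulr_sumr; apply: ler_sum => i _.
rewrite mulr_sumr; apply: ler_sum => j _.
by rewrite mxE -qnorm1_real ler_qnorm1M.
Qed.

End MatrixNorm.

(** * Jump operators, gaps and membership in [Tkappa] *)

Section TimeScaleFacts.
Import numFieldNormedType.Exports.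
Local Open Scope classical_set_scope.
Variables (R : realType) (T : set R).

Lemma near_dist_le (t e : R) : 0 < e -> \forall s \near t, `|s - t| <= e.
Proof.
move=> /(near_ball t); apply: filterS => s.
by rewrite /ball /= distrC => /ltW.
Qed.

Lemma sigma_jump t u : T u -> t < u ->
  (forall s, T s -> ~ (t < s < u)) -> sigma T t = u.
Proof.
move=> Tu tu nb; rewrite /sigma.
set S := [set s | T s /\ t < s].
have Su : S u by [].
rewrite asboolT; last by exists u.
have Slb : lbound S u.
  by move=> s [Ts ts]; rewrite leNgt; apply/negP => su; apply: (nb s Ts); rewrite ts.
apply/eqP; rewrite eq_le ge_inf //; last by exists u.
by rewrite lb_le_inf //; exists u.
Qed.

Lemma right_scattered_near t : sigma T t <> t ->
  \forall s \near t, T s -> t < s -> False.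
Proof.
rewrite /sigma; set S := [set s | T s /\ t < s].
case: asboolP => [S0 st|S0 _]; last first.
  (* Here [sigma] takes its default value [sup T], and no point of [T] lies to the right of [t] at
     all. *)
  by near=> s => Ts ts; apply: S0; exists s.
have Sb : has_lbound S by exists t => s [_ /ltW].
have ltst : t < inf S.
  rewrite lt_neqAle; apply/andP; split; first by apply/eqP => /esym.
  by apply: lb_le_inf => // s [_ /ltW].
near=> s => Ts ts.
have : inf S <= s by exact: ge_inf.
by rewrite leNgt => /negP; apply; near: s; exact: lt_nbhsl.
Unshelve. all: by end_near. Qed.

(** Since [t < sup T] when [T] is bounded above, [t] competes in the supremum defining [rho (sup T)]
    and so escapes the removed interval. *)
Lemma Tkappa_lt t u : T t -> T u -> t < u -> Tkappa T t.
Proof.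
move=> Tt Tu tu; split=> // Tb /andP[+ _].
have St : [set s | T s /\ s < sup T] t.
  by split=> //; exact: lt_le_trans tu (ub_le_sup Tb Tu).
rewrite /rho asboolT; last by exists t.
rewrite ltNge => /negP; apply; apply: ub_le_sup => //.
by exists (sup T) => s [_ /ltW].
Qed.

Lemma left_limit_dense t :
  (forall e, 0 < e -> exists2 s, T s & t - e < s < t) -> rho T t = t.
Proof.
move=> lim; rewrite /rho; set S := [set s | T s /\ s < t].
have S0 : S !=set0.
  by have [s Ts /andP[_ st]] := lim 1 ltr01; exists s.
have Sb : has_ubound S by exists t => s [_ /ltW].
rewrite asboolT //; apply/eqP; rewrite eq_le; apply/andP; split.
  by apply: ge_sup => // s [_ /ltW].
rewrite leNgt; apply/negP => st.
have [|s Ts /andP[]] := lim (t - sup S); first by rewrite subr_gt0.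
rewrite opprB addrC subrK => ss st'.
by have := ub_le_sup Sb (conj Ts st'); rewrite leNgt ss.
Qed.

(** If [t = sup T], left-density makes the removed interval empty. Otherwise some point of [T] lies
    beyond [t] and [Tkappa_lt] applies. *)
Lemma left_limit_Tkappa t : T t ->
  (forall e, 0 < e -> exists2 s, T s & t - e < s < t) -> Tkappa T t.
Proof.
move=> Tt lim; split=> // Tb /andP[rt].
rewrite le_eqVlt => /orP[/eqP ts|ts].
  by move: rt; rewrite -ts left_limit_dense // ltxx.
have T0 : T !=set0 by exists t.
have [|u Tu tu] := sup_adherent (eps := sup T - t) _ (conj T0 Tb).
  by rewrite subr_gt0.
have := @Tkappa_lt t u Tt Tu; rewrite opprB addrC subrK in tu.
by move=> /(_ tu)[_ /(_ Tb)]; rewrite rt (ltW ts); exact.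
Qed.

End TimeScaleFacts.

(** * Delta derivatives in the matrix norm *)

Section DeltaDerivative.
Import numFieldNormedType.Exports.
Local Open Scope classical_set_scope.
Variables (R : realType) (T : set R).
Notation H := (quat R).

(** One estimate for the whole matrix replaces the entrywise ones. The real factor may stand on the
    left because reals are central in the quaternions. *)
Definition mxderiv m n (g : R -> 'M[H]_(m, n)) t (D : 'M[H]_(m, n)) :=
  forall e, 0 < e -> \forall s \near t, T s ->
    mxnorm1 (g (sigma T t) - g s - qreal (sigma T t - s) *: D) <= e * `|sigma T t - s|.

Lemma is_delta_derive_mxderiv m n (g : R -> 'M[H]_(m, n)) t D :
  is_delta_derive_mx T g t D -> mxderiv g t D.
Proof.
move=> gD e e0.
(* The factor 4 compares [qnorm1] with [qnorm], [m * n] counts the entries, and the added 1 keeps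
   [c] positive for empty matrices. *)
pose c : R := 4 * (m * n)%:R + 1.
have c0 : 0 < c by rewrite /c ltr_wpDl // mulr_ge0.
pose G i j s := T s -> qnorm (g (sigma T t) i j - g s i j -
  D i j * qreal (sigma T t - s)) <= (e / c) * `|sigma T t - s|.
have H0 : \forall s \near t, forall i j, G i j s.
  apply: (@filter_forall _ _ (fun i s => forall j, G i j s) (nbhs t)) => i.
  apply: (@filter_forall _ _ (G i) (nbhs t)) => j.
  have [d d0 gd] := gD i j (e / c) (divr_gt0 e0 c0).
  apply/nbhs_ballP; exists d => //= s ds Ts; apply: gd => //.
  by move: ds; rewrite /ball /= ltr_distlC.
apply: filterS H0 => s gs Ts.
apply: (@le_trans _ _ (\sum_(i < m) \sum_(j < n) 4 * ((e / c) * `|sigma T t - s|))).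
  apply: ler_sum => i _; apply: ler_sum => j _.
  apply: le_trans (qnorm1_le_qnorm _) _; rewrite ler_wpM2l //.
  by rewrite !mxE qreal_comm; exact: (gs i j).
rewrite !sumr_const !card_ord -mulrnA (mulnC n) -[leLHS]mulr_natr.
have -> : 4 * (e / c * `|sigma T t - s|) * (m * n)%:R =
          (4 * (m * n)%:R / c) * (e * `|sigma T t - s|).
  by field; rewrite gt_eqF.
rewrite -[leRHS]mul1r ler_wpM2r // ?mulr_ge0 // ?ltW //.
by rewrite ltr_pdivrMr // mul1r /c ltrDl.
Qed.

Lemma mxderivB m n (g h : R -> 'M[H]_(m, n)) t D E :
  mxderiv g t D -> mxderiv h t E ->
  mxderiv (fun s => g s - h s) t (D - E).
Proof.
move=> gD hE e e0; have e20 : 0 < e / 2 by rewrite divr_gt0.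
apply: filterS2 (gD _ e20) (hE _ e20) => s gs hs Ts.
have {gs hs} := lerD (gs Ts) (hs Ts); rewrite -mulrDl -splitr.
apply: le_trans; apply: le_trans (ler_mxnorm1B _ _).
rewrite le_eqVlt; apply/orP; left; apply/eqP; congr mxnorm1.
have K (V : zmodType) (a b c d : V) : a - b - (c - d) = a - c - (b - d).
  by rewrite opprD addrACA -opprD.
by rewrite scalerBr [X in X - _ = _]K [LHS]K.
Qed.

Lemma mxderivMr m n p (g : R -> 'M[H]_(m, n)) t D (q : 'M[H]_(n, p)) :
  mxderiv g t D -> mxderiv (fun s => g s *m q) t (D *m q).
Proof.
move=> gD e e0.
have q1 : 0 < mxnorm1 q + 1 by rewrite ltr_wpDl // mxnorm1_ge0.
apply: filterS (gD _ (divr_gt0 e0 q1)) => s gs Ts.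
rewrite scalemxAl -!mulmxBl; apply: le_trans (ler_mxnorm1M _ _) _.
apply: le_trans (ler_wpM2r (mxnorm1_ge0 _) (gs Ts)) _.
have -> : e / (mxnorm1 q + 1) * `|sigma T t - s| * mxnorm1 q =
          (e * `|sigma T t - s|) * (mxnorm1 q / (mxnorm1 q + 1)).
  by field; rewrite gt_eqF.
rewrite ler_piMr ?mulr_ge0 // ?ltW //.
by rewrite ltr_pdivrMr // mul1r ltrDl.
Qed.

(** Taking [s = t] in the definition bounds the defect by [e * |sigma t - t|] for every [e > 0], so
    it is zero. *)
Lemma mxderiv_jump m n (g : R -> 'M[H]_(m, n)) t D : T t ->
  mxderiv g t D -> g (sigma T t) - g t = qreal (sigma T t - t) *: D.
Proof.
move=> Tt gD; apply/eqP; rewrite -subr_eq0; apply/eqP; apply: mxnorm1_le0.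
apply/ler_addgt0Pl => e e0.
have c0 : 0 < `|sigma T t - t| + 1 by rewrite ltr_wpDl.
have := nbhs_singleton (gD _ (divr_gt0 e0 c0)) Tt.
move=> /le_trans; apply; rewrite addr0 mulrAC ler_pdivrMr //.
by rewrite ler_pM2l // lerDl.
Qed.

(** Subtracting the remainder at [s] from the exact jump formula writes an increment as a linear
    term plus a controlled error. *)
Lemma mxderiv_incr m n (g : R -> 'M[H]_(m, n)) t s D : T t ->
  mxderiv g t D ->
  g s - g t = qreal (s - t) *: D -
              (g (sigma T t) - g s - qreal (sigma T t - s) *: D).
Proof.
move=> Tt /(mxderiv_jump Tt) J.
have -> : s - t = (sigma T t - t) - (sigma T t - s) by lra.
rewrite qrealB scalerBl -J.
by rewrite !opprB addrA subrK [RHS]addrC addrA subrK.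
Qed.

Lemma mxderiv_continuous m n (g : R -> 'M[H]_(m, n)) t D : T t ->
  mxderiv g t D ->
  forall e, 0 < e -> \forall s \near t, T s -> mxnorm1 (g s - g t) <= e.
Proof.
move=> Tt gD e e0.
have c0 : 0 < `|sigma T t - t| + 1 by rewrite ltr_wpDl.
have d0 : 0 < mxnorm1 D + 1 by rewrite ltr_wpDl // mxnorm1_ge0.
near=> s => Ts.
rewrite (mxderiv_incr s Tt gD).
have st1 : `|s - t| <= 1 by near: s; exact: near_dist_le.
(* The linear term and the remainder each get [e / 2]. For the latter, [|s - t| <= 1] gives
   [|sigma t - s| <= |sigma t - t| + 1]. *)
have st2 : `|s - t| <= e / 2 / (mxnorm1 D + 1).
  by near: s; apply: near_dist_le; rewrite !divr_gt0.
have rem : mxnorm1 (g (sigma T t) - g s - qreal (sigma T t - s) *: D) <=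
    e / 2 / (`|sigma T t - t| + 1) * `|sigma T t - s|.
  by move: Ts; near: s; apply: gD; rewrite !divr_gt0.
rewrite [leRHS]splitr; apply: le_trans (ler_mxnorm1B _ _) _.
apply: lerD.
  apply: le_trans (ler_mxnorm1Z _ _) _.
  move: st2; rewrite ler_pdivlMr // => /(le_trans _); apply.
  by rewrite ler_wpM2l // lerDl.
apply: (le_trans rem); rewrite mulrAC ler_pdivrMr // ler_wpM2l //.
  by rewrite divr_ge0 // ltW.
have -> : sigma T t - s = (sigma T t - t) - (s - t) by lra.
by apply: le_trans (ler_normB _ _) _; rewrite lerD2l.
Unshelve. all: by end_near. Qed.

End DeltaDerivative.

(** * Mean value inequality and contraction *)

Section MeanValue.
Import numFieldNormedType.Exports.
Local Open Scope classical_set_scope.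
Variables (R : realType) (T : set R).
Hypothesis cT : closed T.
Notation H := (quat R).

(** With the slope relaxed to [L + e], the bound propagates from [a] by closed-set induction: the
    jump formula crosses gaps, the derivative estimate leaves right-dense points, and continuity
    reaches left limits. Then [e] tends to 0. *)
Lemma mean_value_le m n (g D : R -> 'M[H]_(m, n)) a b L :
  T a -> T b -> a <= b ->
  (forall t, Tkappa T t -> mxderiv T g t (D t)) ->
  (forall t, T t -> a <= t -> t < b -> mxnorm1 (D t) <= L) ->
  mxnorm1 (g b - g a) <= L * (b - a).
Proof.
move=> Ta Tb ab gD DL.
have Tk t : T t -> t < b -> Tkappa T t by move=> Tt; exact: Tkappa_lt.
have step x y z : g z - g x = (g z - g y) + (g y - g x) by rewrite addrA subrK.
suff H0 e : 0 < e -> forall t, T t -> a <= t ->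
    t <= b -> mxnorm1 (g t - g a) <= (L + e) * (t - a).
  apply/ler_addgt0Pl => e e0.
  have c0 : 0 < b - a + 1 by lra.
  (* The slack [e / (b - a + 1)] accumulates to at most [e] over the interval. *)
  apply: le_trans (H0 _ (divr_gt0 e0 c0) b Tb ab (lexx _)) _.
  rewrite mulrDl addrC lerD2r mulrAC ler_pdivrMr // ler_pM2l //; lra.
move=> e0; apply: closed_set_ind_right => //.
- by rewrite !subrr mxnorm10 mulr0.
- move=> t u Tt Tu at_ tu nb Pt ub.
  have tb := lt_le_trans tu ub.
  have := mxderiv_jump Tt (gD _ (Tk _ Tt tb)).
  rewrite (sigma_jump Tu tu nb) (step a t u) => ->.
  apply: le_trans (ler_mxnorm1D _ _) _.
  have -> : (L + e) * (u - a) = (L + e) * (u - t) + (L + e) * (t - a) by ring.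
  apply: lerD (Pt (ltW tb)); apply: le_trans (ler_mxnorm1Z _ _) _.
  rewrite gtr0_norm ?subr_gt0 // mulrC ler_wpM2r ?subr_ge0 ?(ltW tu) //.
  by apply: le_trans (DL _ Tt at_ tb) _; rewrite lerDl ltW.
- move=> t Tt at_ Pt.
  have [bt|tb] := leP b t.
    near=> s => Ts ts sb.
    by have := lt_le_trans (le_lt_trans bt ts) sb; rewrite ltxx.
  have [st|/eqP/right_scattered_near] := eqVneq (sigma T t) t; last first.
    by apply: filterS => s H1 Ts ts; have := H1 Ts ts.
  (* At a right-dense [t] the linear term costs [L * (s - t)] and the remainder [e * (s - t)]. *)
  have := gD _ (Tk _ Tt tb) _ e0.
  apply: filterS => s H1 Ts ts sb.
  have {H1} := H1 Ts; rewrite st => H1.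
  rewrite (step a t s); apply: le_trans (ler_mxnorm1D _ _) _.
  have -> : (L + e) * (s - a) = (L + e) * (s - t) + (L + e) * (t - a) by ring.
  apply: lerD (Pt (ltW tb)).
  have := mxderiv_incr s Tt (gD _ (Tk _ Tt tb)); rewrite st => ->.
  apply: le_trans (ler_mxnorm1B _ _) _; rewrite mulrDl; apply: lerD.
    apply: le_trans (ler_mxnorm1Z _ _) _.
    rewrite gtr0_norm ?subr_gt0 // mulrC ler_wpM2r ?subr_ge0 ?(ltW ts) //.
    exact: DL.
  by apply: le_trans H1 _; rewrite distrC gtr0_norm ?subr_gt0.
- move=> t Tt at_ lim Pt tb; apply/ler_addgt0Pl => d d0.
  have /nbhs_ballP[r /= r0 near_t] :=
    mxderiv_continuous Tt (gD _ (left_limit_Tkappa Tt lim)) d0.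
  (* This radius places [s] both where [g] is within [d] of [g t] and to the right of [a], where the
     induction hypothesis applies. *)
  pose r' := Num.min r (t - a).
  have r'0 : 0 < r' by rewrite lt_min r0 subr_gt0.
  have [s Ts /andP[ts st]] := lim _ r'0.
  have sr : t - s < r.
    by apply: lt_le_trans (_ : r' <= r); [lra | rewrite ge_min lexx].
  have sa : t - s < t - a.
    by apply: lt_le_trans (_ : r' <= t - a); [lra | rewrite ge_min lexx orbT].
  rewrite (step a s t); apply: le_trans (ler_mxnorm1D _ _) _; apply: lerD.
    rewrite -mxnorm1N opprB; apply: near_t => //.
    by rewrite /ball /= gtr0_norm ?subr_gt0.
  have as_ : a <= s by lra.
  have sb : s < b by exact: lt_le_trans st tb.
  apply: le_trans (Pt _ Ts as_ st (ltW sb)) _.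
  have L0 : 0 <= L by exact: le_trans (mxnorm1_ge0 _) (DL _ Ts as_ sb).
  rewrite ler_wpM2l //; lra.
Unshelve. all: by end_near. Qed.

(** The a priori bound 1 makes the supremum of [h] on [S] finite; being itself a bound, it is at
    most half of itself. *)
Lemma contraction_eq0 (S : set R) (h : R -> R) :
  (forall s, S s -> 0 <= h s <= 1) ->
  (forall B, (forall s, S s -> h s <= B) -> forall s, S s -> h s <= B / 2) ->
  forall s, S s -> h s = 0.
Proof.
move=> h01 half s Ss.
have hb : has_ubound (h @` S) by exists 1 => _ [t St <-]; have /andP[] := h01 _ St.
have hs t : S t -> h t <= sup (h @` S).
  by move=> St; apply: ub_le_sup => //; exists t.
have : sup (h @` S) <= sup (h @` S) / 2.
  by apply: ge_sup; [exists (h s), s | move=> _ [t St <-]; exact: half].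
have := hs _ Ss; have /andP[h0 _] := h01 _ Ss => hle le2.
by apply/eqP; rewrite eq_le h0 andbT; lra.
Qed.

(** * Local boundedness of the coefficient matrix *)

Variables (n : nat) (A : R -> 'M[H]_n).
Hypothesis Ard : rd_regressive T A.

Lemma mxnorm1_bounded_near (F : set_system R) : Filter F ->
  (forall i j, exists K, \forall s \near F, qnorm1 (A s i j) <= K) ->
  exists2 K, 0 <= K & \forall s \near F, mxnorm1 (A s) <= K.
Proof.
move=> FF AK.
have [K KP] : exists K : 'I_n -> 'I_n -> R,
    forall i j, \forall s \near F, qnorm1 (A s i j) <= K i j.
  have {}AK i := fin_all_exists (AK i).
  exact: fin_all_exists AK.
exists (\sum_i \sum_j `|K i j|); first by do 2 apply: sumr_ge0 => ? _.
have : \forall s \near F, forall i j, qnorm1 (A s i j) <= K i j.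
  apply: (@filter_forall _ _ (fun i s => forall j, qnorm1 (A s i j) <= K i j) F) => i.
  exact: (@filter_forall _ _ (fun j s => qnorm1 (A s i j) <= K i j) F).
apply: filterS => s AsK; apply: ler_sum => i _; apply: ler_sum => j _.
exact: le_trans (AsK i j) (ler_norm _).
Qed.

(** Each component eventually stays within 1 of its limit. *)
Lemma qnorm1_bounded_near (F : set_system R) (g : R -> H) a b c d : Filter F ->
  q_1 (g s) @[s --> F] --> (a : R) -> q_i (g s) @[s --> F] --> (b : R) ->
  q_j (g s) @[s --> F] --> (c : R) -> q_k (g s) @[s --> F] --> (d : R) ->
  exists K, \forall s \near F, qnorm1 (g s) <= K.
Proof.
move=> FF.
have bnd (h : R -> R) (l : R) : h s @[s --> F] --> l ->
    \forall s \near F, `|h s| <= `|l| + 1.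
  move=> /cvgrPdist_le /(_ 1 ltr01); apply: filterS => s hs.
  rewrite -[h s](subKr l); apply: le_trans (ler_normB _ _) _.
  by rewrite lerD2l.
move=> /bnd g1 /bnd g2 /bnd g3 /bnd g4.
exists (`|a| + 1 + (`|b| + 1) + (`|c| + 1) + (`|d| + 1)).
near=> s; rewrite /qnorm1; do 3 (apply: lerD; last by near: s).
by near: s.
Unshelve. all: by end_near. Qed.

Lemma rd_bounded_near t : T t -> right_dense T t ->
  exists2 K, 0 <= K & \forall s \near t, T s -> mxnorm1 (A s) <= K.
Proof.
move=> Tt st.
have [|K K0 AK] := @mxnorm1_bounded_near (within T (nbhs t)) _; last by exists K.
move=> i j; have [Aij _] := Ard; have [A1 A2 A3 A4] := Aij i j.
exact: qnorm1_bounded_near ((A1 _ Tt).1 st) ((A2 _ Tt).1 st)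
  ((A3 _ Tt).1 st) ((A4 _ Tt).1 st).
Qed.

Lemma rd_bounded_near_left t : T t -> left_dense T t ->
  exists2 K, 0 <= K & \forall s \near t, T s -> s < t -> mxnorm1 (A s) <= K.
Proof.
move=> Tt rt.
have [|K K0 AK] := @mxnorm1_bounded_near (within T t^'-) _; last first.
  exists K => //; move: AK; rewrite !near_withinE.
  by apply: filterS => s AK Ts ts; exact: AK.
move=> i j; have [Aij _] := Ard; have [A1 A2 A3 A4] := Aij i j.
have [[l1 L1] [l2 L2] [l3 L3] [l4 L4]] :=
  And4 ((A1 _ Tt).2 rt) ((A2 _ Tt).2 rt) ((A3 _ Tt).2 rt) ((A4 _ Tt).2 rt).
exact: qnorm1_bounded_near L1 L2 L3 L4.
Qed.

(** * Propagation of zeros of a homogeneous solution *)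

Variable x : R -> 'cV[H]_n.
Hypothesis x_sol : forall t, Tkappa T t -> mxderiv T x t (A t *m x t).

(* On [S], of radius at most 1/(2(K + 1)) about [c], the mean value inequality
   halves any bound on [x].  [K] need not bound [A] at [sup S]: a left limit
   of [A] at a left-dense point says nothing about its value there. *)
Lemma solution_eq0_local (S : set R) (K : R) c : S c -> x c = 0 -> 0 <= K ->
  S `<=` T -> (forall s t u, S s -> S u -> T t -> s <= t <= u -> S t) ->
  (forall s t, S s -> S t -> s < t -> mxnorm1 (A s) <= K) ->
  (forall s, S s -> `|s - c| <= (2 * (K + 1))^-1) ->
  (forall s, S s -> mxnorm1 (x s - x c) <= 1) ->
  forall s, S s -> x s = 0.
Proof.
move=> Sc xc0 K0 ST Sconv AK Sdiam x1 s Ss.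
have K1 : 0 < 2 * (K + 1) by rewrite mulr_gt0 // ltr_wpDl.
apply: mxnorm1_le0; rewrite -[leLHS]/(mxnorm1 (x s)).
rewrite (@contraction_eq0 S (fun s => mxnorm1 (x s))) // => [t St|B xB t St].
  by rewrite mxnorm1_ge0 -[x t]subr0 -xc0 x1.
have B0 : 0 <= B by exact: le_trans (mxnorm1_ge0 _) (xB _ St).
have Ax u v : S u -> S v -> u < v -> mxnorm1 (A u *m x u) <= K * B.
  move=> Su Sv uv; apply: le_trans (ler_mxnorm1M _ _) _.
  by apply: ler_pM; rewrite ?mxnorm1_ge0 ?xB // (AK u v).
have mv u v : S u -> S v -> u <= v -> mxnorm1 (x v - x u) <= K * B * (v - u).
  (* Convexity of [S] in [T] puts the intermediate points in [S]. The derivative is only bounded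
     strictly before [v], which is where [AK] applies. *)
  move=> Su Sv uv; apply: mean_value_le x_sol _ => //; try exact: ST.
  move=> w Tw uw wv; apply: (Ax w v) => //; apply: (Sconv u w v) => //.
  by rewrite uw ltW.
have : mxnorm1 (x t) <= K * B * `|t - c|.
  have [tc|ct] := leP t c.
    rewrite -[x t]subr0 -xc0 -mxnorm1N opprB; apply: le_trans (mv _ _ St Sc tc) _.
    by rewrite ler0_norm ?subr_le0 // opprB.
  rewrite -[x t]subr0 -xc0; apply: le_trans (mv _ _ Sc St (ltW ct)) _.
  by rewrite gtr0_norm ?subr_gt0.
move=> /le_trans; apply.
apply: le_trans (ler_wpM2l (mulr_ge0 K0 B0) (Sdiam _ St)) _.
(* The choice of radius makes the factor [K / (2 * (K + 1))], at most one half. *)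
by rewrite ler_pdivrMr //; nra.
Qed.

(** Only a right-dense [c] has points of [T] arbitrarily close on its right. There [A] is bounded by
    continuity, and the local lemma applies to [T] in a short interval starting at [c]. *)
Lemma solution_eq0_right c : T c -> x c = 0 ->
  \forall s \near c, T s -> c < s -> x s = 0.
Proof.
move=> Tc xc0.
have [sc|/eqP/right_scattered_near] := eqVneq (sigma T c) c; last first.
  by apply: filterS => s H1 Ts cs; have := H1 Ts cs.
(* A later point of [T] puts [c] in [Tkappa], so that [x] is continuous at [c]. *)
have [[u Tu cu]|nu] := pselect (exists2 u, T u & c < u); last first.
  by near=> s => Ts cs; case: nu; exists s.
have [K K0 AK] := rd_bounded_near Tc sc.
have x1 := mxderiv_continuous Tc (x_sol (Tkappa_lt Tc Tu cu)) ltr01.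
have K1 : 0 < (2 * (K + 1))^-1 by rewrite invr_gt0 mulr_gt0 // ltr_wpDl.
have /nbhs_ballP[r /= r0 rP] : \forall s \near c,
    [/\ T s -> mxnorm1 (A s) <= K, T s -> mxnorm1 (x s - x c) <= 1 &
       `|s - c| <= (2 * (K + 1))^-1].
  by apply: filterS3 AK x1 (near_dist_le c K1) => s.
have inr s : c <= s -> s < c + r -> ball c r s.
  by move=> cs sr; rewrite /ball /= ler0_norm ?subr_le0 //; lra.
have S0 := @solution_eq0_local [set s | [/\ T s, c <= s & s < c + r]] K c.
apply/nbhs_ballP; exists r => //= s; rewrite /ball /= ltr_distlC => /andP[_ sr] Ts cs.
apply: S0 => //; last by split=> //; exact: ltW.
- by split=> //; rewrite ltrDl.
- by move=> t [].
- move=> a b d [_ ca _] [_ _ dr] Tb /andP[ab bd].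
  by split=> //; [exact: le_trans ca ab | exact: le_lt_trans bd dr].
- by move=> a b [Ta ca ar] _ _; have [+ _ _] := rP _ (inr _ ca ar); exact.
- by move=> a [Ta ca ar]; have [_ _] := rP _ (inr _ ca ar).
- by move=> a [Ta ca ar]; have [_ + _] := rP _ (inr _ ca ar); exact.
Unshelve. all: by end_near. Qed.

Lemma solution_eq0_left c : T c -> x c = 0 ->
  \forall s \near c, T s -> s < c -> x s = 0.
Proof.
move=> Tc xc0.
have [lim|] := pselect (forall e, 0 < e -> exists2 s, T s & c - e < s < c);
    last first.
  (* Without left accumulation at [c], some interval just before [c] misses [T]. *)
  move=> /existsNP[e /not_implyP[e0 ne]]; apply/nbhs_ballP; exists e => //= s.
  rewrite /ball /= ltr_distlC => /andP[se _] Ts sc.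
  by case: ne; exists s; rewrite ?se.
have [K K0 AK] := rd_bounded_near_left Tc (left_limit_dense lim).
have x1 := mxderiv_continuous Tc (x_sol (left_limit_Tkappa Tc lim)) ltr01.
have K1 : 0 < (2 * (K + 1))^-1 by rewrite invr_gt0 mulr_gt0 // ltr_wpDl.
have /nbhs_ballP[r /= r0 rP] : \forall s \near c,
    [/\ T s -> s < c -> mxnorm1 (A s) <= K, T s -> mxnorm1 (x s - x c) <= 1 &
       `|s - c| <= (2 * (K + 1))^-1].
  by apply: filterS3 AK x1 (near_dist_le c K1) => s.
have inr s : s <= c -> c - r < s -> ball c r s.
  by move=> cs sr; rewrite /ball /= ger0_norm ?subr_ge0 //; lra.
have S0 := @solution_eq0_local [set s | [/\ T s, s <= c & c - r < s]] K c.
apply/nbhs_ballP; exists r => //= s; rewrite /ball /= ltr_distlC => /andP[sr _] Ts sc.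
apply: S0 => //; last by split=> //; exact: ltW.
- by split=> //; lra.
- by move=> t [].
- move=> a b d [_ _ ra] [_ dc _] Tb /andP[ab bd].
  by split=> //; [exact: le_trans bd dc | exact: lt_le_trans ra ab].
(* The bound on [A] holds only before [c]; it is available at [a] because [a < b <= c]. *)
- move=> a b [Ta ac ra] [_ bc _] ab.
  by have [+ _ _] := rP _ (inr _ ac ra); apply => //; exact: lt_le_trans ab bc.
- by move=> a [Ta ca ar]; have [_ _] := rP _ (inr _ ca ar).
- by move=> a [Ta ca ar]; have [_ + _] := rP _ (inr _ ca ar); exact.
Qed.

Lemma solution_eq0_limit c : T c -> Tkappa T c ->
  (forall e, 0 < e -> exists s, [/\ T s, `|s - c| < e & x s = 0]) -> x c = 0.
Proof.
move=> Tc kc lim; apply: mxnorm1_le0; apply/ler_addgt0Pl => e e0.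
have /nbhs_ballP[r /= r0 rP] := mxderiv_continuous Tc (x_sol kc) e0.
have [s [Ts sr xs]] := lim _ r0.
rewrite addr0 -mxnorm1N -[- x c]add0r -xs; apply: rP => //.
by rewrite /ball /= distrC.
Qed.

Lemma solution_eq0 t0 : T t0 -> x t0 = 0 -> forall t, T t -> x t = 0.
Proof.
move=> T0 x0 t Tt; have [tt0|t0t] := leP t t0.
  apply: (closed_set_ind_left (P := fun s => x s = 0) cT T0 x0) tt0 => //.
  - move=> a b Ta Tb _ ab nb xb.
    have ka := Tkappa_lt Ta Tb ab.
    have sab := sigma_jump Tb ab nb.
    have := mxderiv_jump Ta (x_sol ka); rewrite sab xb sub0r => xa.
    (* The jump formula reads [0 = (1 + mu a A a) x a]; the left inverse [C] cancels the factor. *)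
    have [_ /(_ _ ka)[C [_ CA]]] := Ard.
    rewrite -[x a]mul1mx -CA -mulmxA mulmxDl mul1mx -scalemxAl /mu sab -xa.
    by rewrite subrr mulmx0.
  - by move=> a Ta _; exact: solution_eq0_left.
  - move=> a Ta at0 lim xr; apply: solution_eq0_limit => //.
      exact: Tkappa_lt Ta T0 at0.
    (* The minimum keeps [s] before [t0], within reach of the induction hypothesis. *)
    move=> e e0; have d0 : 0 < Num.min e (t0 - a) by rewrite lt_min e0 subr_gt0.
    have [s Ts /andP[as_ sd]] := lim _ d0; exists s.
    move: sd; rewrite -ltrBlDl lt_min => /andP[se st].
    split=> //; first by rewrite gtr0_norm // subr_gt0.
    by apply: xr => //; lra.
apply: (closed_set_ind_right (P := fun s => x s = 0) cT T0 x0) (ltW t0t) => //.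
- move=> a b Ta Tb _ ab nb xa.
  have := mxderiv_jump Ta (x_sol (Tkappa_lt Ta Tb ab)).
  by rewrite (sigma_jump Tb ab nb) xa mulmx0 scaler0 subr0.
- by move=> a Ta _; exact: solution_eq0_right.
- move=> a Ta at0 lim xl; apply: solution_eq0_limit => //.
    exact: left_limit_Tkappa.
  move=> e e0; have d0 : 0 < Num.min e (a - t0) by rewrite lt_min e0 subr_gt0.
  have [s Ts /andP[ds sa]] := lim _ d0; exists s.
  have : a - s < Num.min e (a - t0) by lra.
  rewrite lt_min => /andP[se st].
  split=> //; first by rewrite distrC gtr0_norm // subr_gt0.
  by apply: xl => //; lra.
Qed.

End MeanValue.

(** * Square quaternion systems through real coordinates *)

Section LinearAlgebra.
Variables (R : realType).
Notation H := (quat R).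

Definition coords n (v : 'cV[H]_n) : 'M[R]_(n, 4) :=
  \matrix_(i, j) tnth [tuple q_1 (v i 0); q_i (v i 0); q_j (v i 0); q_k (v i 0)] j.

Definition of_coords n (u : 'M[R]_(n, 4)) : 'cV[H]_n :=
  \col_i Quat (u i 0) (u i 1) (u i 2%:R) (u i 3%:R).

Lemma coordsK n : cancel (@coords n) (@of_coords n).
Proof.
move=> v; apply/colP => i; rewrite !mxE !(tnth_nth 0) /=.
by case: (v i 0).
Qed.

Lemma of_coordsK n : cancel (@of_coords n) (@coords n).
Proof.
move=> u; apply/matrixP => i j; rewrite !mxE (tnth_nth 0) /=.
case: j => [[|[|[|[|j]]]] //= jlt]; congr (u i _); exact: val_inj.
Qed.

Lemma of_coords_linear n a (u v : 'M[R]_(n, 4)) :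
  of_coords (a *: u + v) = qreal a *: of_coords u + of_coords v.
Proof. by apply/colP => i; rewrite !mxE; congr Quat => /=; ring. Qed.

(* An injective [H]-linear endomorphism of [H^n] is an injective endomorphism
   of the real vector space [R^(4n)]. *)
Lemma injective_mulmx_surjective n (B : 'M[H]_n) :
  (forall v : 'cV[H]_n, B *m v = 0 -> v = 0) ->
  forall w : 'cV[H]_n, exists v : 'cV[H]_n, B *m v = w.
Proof.
move=> Binj w.
pose f u := coords (B *m of_coords u).
have f_lin : linear f.
  move=> a u v; apply: (can_inj (@of_coordsK n)).
  rewrite of_coords_linear !coordsK of_coords_linear mulmxDr; congr (_ + _).
  (* Left multiplication by [B] is real-linear because real scalars commute past its entries. *)
  apply/colP => i; rewrite !mxE mulr_sumr; apply: eq_bigr => j _.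
  by rewrite !mxE mulrA -qreal_comm mulrA.
pose fL : {linear _ -> _} := HB.pack f (GRing.isLinear.Build _ _ _ _ f f_lin).
have ker0 : lker (linfun fL) == 0%VS.
  apply/lker0P => u v; rewrite !lfunE /= => /(can_inj (@coordsK n)) /eqP.
  rewrite -subr_eq0 -mulmxBr => /eqP /Binj /eqP; rewrite subr_eq0 => /eqP.
  exact: (can_inj (@of_coordsK n)).
(* In finite dimension an endomorphism with trivial kernel is invertible; the preimage of [w] is
   read off from its inverse. *)
have /(congr1 (@of_coords n)) := lker0_lfunVK ker0 (coords w).
by rewrite lfunE /= !coordsK => Bw; eexists; exact: Bw.
Qed.

End LinearAlgebra.

(** * Structure of the solutions of the nonhomogeneous equation *)

Theorem theorem4p23 (R : realType) (T : set R) (n : nat)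
  (A : R -> 'M[quat R]_n) (f : R -> 'cV[quat R]_n)
  (M : R -> 'M[quat R]_n) (phi0 : R -> 'cV[quat R]_n) :
  time_scale T ->
  rd_regressive T A ->
  fundamental_matrix T A M ->
  is_solution T (fun t v => A t *m v + f t) phi0 ->
  forall phi : R -> 'cV[quat R]_n,
    is_solution T (fun t v => A t *m v + f t) phi ->
    exists q : 'cV[quat R]_n, forall t, T t -> phi t = M t *m q + phi0 t.
Proof.
move=> [cT [t0 T0]] Ard [Msol Mindep] phi0sol phi phisol.
have Mderiv t : Tkappa T t -> mxderiv T M t (A t *m M t).
  move=> kt; apply: is_delta_derive_mxderiv => i j.
  have -> : (A t *m M t) i j = (A t *m col j (M t)) i 0.
    by rewrite !mxE; apply: eq_bigr => k _; rewrite mxE.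
  have -> : (fun s => M s i j) = (fun s => col j (M s) i 0).
    by apply/funext => s; rewrite mxE.
  exact: Msol.
have Mq_deriv (q : 'cV[quat R]_n) t :
    Tkappa T t -> mxderiv T (fun s => M s *m q) t (A t *m (M t *m q)).
  by move=> kt; rewrite mulmxA; exact: mxderivMr (Mderiv t kt).
(* If [M t0 v = 0], the solution [M v] vanishes on all of [T]. It is the combination of the columns
   with right coefficients [v j 0], so independence gives [v = 0]. *)
have Minj (v : 'cV[quat R]_n) : M t0 *m v = 0 -> v = 0.
  move=> Mv0; apply/colP => j; rewrite mxE.
  apply: (Mindep (fun j => v j 0)) => t Tt.
  transitivity (M t *m v); last first.
    exact: (solution_eq0 cT Ard (Mq_deriv v) T0 Mv0 Tt).
  by apply/colP => i; rewrite mxE summxE; apply: eq_bigr => k _; rewrite !mxE.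
have [q Mq] := injective_mulmx_surjective Minj (phi t0 - phi0 t0).
exists q => t Tt; apply/eqP; rewrite -subr_eq0 [M t *m q + _]addrC opprD addrA; apply/eqP.
(* The forcing terms cancel, so [x] solves the homogeneous equation, and the choice of [q] makes it
   vanish at [t0]. *)
pose x s := phi s - phi0 s - M s *m q.
have xsol s : Tkappa T s -> mxderiv T x s (A s *m x s).
  move=> ks; rewrite /x !mulmxBr; apply: mxderivB; last exact: Mq_deriv.
  have -> : A s *m phi s - A s *m phi0 s =
      (A s *m phi s + f s) - (A s *m phi0 s + f s).
    by rewrite opprD addrACA subrr addr0.
  by apply: mxderivB; apply: is_delta_derive_mxderiv; [exact: phisol|exact: phi0sol].
by apply: (solution_eq0 cT Ard xsol T0 _ Tt); rewrite /x Mq subrr.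
Qed.
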